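(* Let $f:{}^*\mathbb{R}^n\to{}^*\mathbb{R}$ be an internal mu-differentiable function and let $a\in\mathbb{R}^n$ be a local m-minimizer of $f$. Then $$\left.\frac{\partial f}{\partial x_i}\right|_{a}\approx 0\quad\text{for every } i=1,\ldots,n.$$
   Context: Setting: nonstandard analysis; ${}^*\mathbb{R}$ is the field of hyperreals and ${}^*\mathbb{R}^n$ the nonstandard extension of Euclidean space $\mathbb{R}^n$ with $n$ a standard positive integer (the extension satisfies the Transfer Principle), with the usual notion of internal sets and functions; $|\cdot|$ is the (extended) Euclidean norm. A vector (or hyperreal) $x$ is infinitesimal, $x\approx 0$, if $|x|<r$ for all real $r>0$; $x\approx y$ means $x-y\approx 0$; $x$ is finite if $|x|<r$ for some real $r>0$; $x\in{}^*\mathbb{R}^n$ is nearstandard, $x\in ns({}^*\mathbb{R}^n)$, if $x\approx b$ for some (unique) $b\in\mathbb{R}^n$. For $x,y\in{}^*\mathbb{R}$ we write $x\gtrsim y$ if $x\ge y$ or $x\approx y$. Mu-differentiability: an internal function $f:{}^*\mathbb{R}^n\to{}^*\mathbb{R}$ is mu-differentiable if $f(ns({}^*\mathbb{R}^n))\subseteq ns({}^*\mathbb{R})$ and there is an internal function $x\mapsto Df_x$ from ${}^*\mathbb{R}^n$ to ${}^*L(\mathbb{R}^n,\mathbb{R})$ (the internal linear maps ${}^*\mathbb{R}^n\to{}^*\mathbb{R}$; this derivative map is in general not unique) such that (1) whenever $x$ is nearstandard, $Df_x$ is a finite map, i.e. it sends finite vectors to finite hyperreals; (2) for each $b\in\mathbb{R}^n$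 there is a positive infinitesimal $\delta_b$ such that for all $x,y\approx b$ with $|x-y|>\delta_b$ there is an infinitesimal $\eta\in{}^*\mathbb{R}$ with $f(x)-f(y)=Df_x(x-y)+|x-y|\eta$. Partial derivatives: writing $Df_x=(f'_1,\ldots,f'_n)$ in coordinates, i.e. $Df_x(\epsilon_1,\ldots,\epsilon_n)=\sum_i f'_i\epsilon_i$, the partial derivative $\left.\frac{\partial f}{\partial x_i}\right|_{x}$ is by definition $f'_i$. A vector $a\in\mathbb{R}^n$ is a local m-minimizer of $f$ if there is a real $r>0$ such that $f(x)\gtrsim f(a)$ for all $x\in{}^*\mathbb{R}^n$ with $|x-a|<r$. *)

(* Defs.v *)
From HB Require Import structures.
From mathcomp Require Import all_boot all_order all_algebra.
From mathcomp Require Import boolp reals.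

Set Implicit Arguments.
Unset Strict Implicit.
Unset Printing Implicit Defensive.

Import Order.TTheory GRing.Theory Num.Theory.
Local Open Scope ring_scope.

(* * Nonstandard extensions

   The standard universe is the full finite-type structure over R, with R^n
   as a base type for each n. Sets and relations are functions into tProp. A
   nonstandard extension is a type-indexed family of "star" domains whose
   elements are the internal objects, together with an embedding of the
   standard objects satisfying the Transfer Principle for all first-order
   sentences (quantifying over every type) with standard parameters. Only the
   Transfer Principle and properness are required, so ultrapowers are one
   instance among others. *)

Inductive ty : Type :=
| tReal
| tVec of nat
| tProp
| tFun of ty & ty.

Fixpoint std (R : realType) (s : ty) : Type :=
  match s with
  | tReal => R
  | tVec n => 'rV[R]_n
  | tProp => Prop
  | tFun s t => std R s -> std R t
  end.

(* Variables are de Bruijn indices, terms and formulas are intrinsically typed.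
   The syntax must not be parametric in a type of variables (as in higher-order
   abstract syntax): with choice, such a "formula" could inspect the structure
   in which it is interpreted, and Transfer would become inconsistent. *)

Inductive var : seq ty -> ty -> Type :=
| VZ G s : var (s :: G) s
| VS G s t : var G t -> var (s :: G) t.

Inductive term (R : realType) (G : seq ty) : ty -> Type :=
| Var s : var G s -> term R G s
| Cst s : std R s -> term R G s
| App s t : term R G (tFun s t) -> term R G s -> term R G t.

Inductive formula (R : realType) : seq ty -> Type :=
| Eq G s : term R G s -> term R G s -> formula R G
| Holds G : term R G tProp -> formula R G
| Fal G : formula R G
| Imp G : formula R G -> formula R G -> formula R G
| And G : formula R G -> formula R G -> formula R G
| Or G : formula R G -> formula R G -> formula R G
| All G s : formula R (s :: G) -> formula R G
| Ex G s : formula R (s :: G) -> formula R G.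

Record frame : Type := Frame {
  dom : ty -> Type;
  app : forall s t, dom (tFun s t) -> dom s -> dom t;
  holds : dom tProp -> Prop
}.

Fixpoint env (F : frame) (G : seq ty) : Type :=
  match G with
  | [::] => unit
  | s :: G => (dom F s * env F G)%type
  end.

Fixpoint lookup (F : frame) G s (x : var G s) : env F G -> dom F s :=
  match x in var G s return env F G -> dom F s with
  | VZ _ _ => fun e => e.1
  | VS _ _ _ x => fun e => lookup x e.2
  end.

Fixpoint eval (R : realType) (F : frame) (c : forall s, std R s -> dom F s)
    G s (u : term R G s) (e : env F G) : dom F s :=
  match u with
  | Var _ x => lookup x e
  | Cst _ a => c _ a
  | App _ _ u v => app (eval c u e) (eval c v e)
  end.

Fixpoint sat (R : realType) (F : frame) (c : forall s, std R s -> dom F s)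
    G (p : formula R G) : env F G -> Prop :=
  match p in formula _ G return env F G -> Prop with
  | Eq _ _ u v => fun e => eval c u e = eval c v e
  | Holds _ u => fun e => holds (eval c u e)
  | Fal _ => fun=> False
  | Imp _ p q => fun e => sat c p e -> sat c q e
  | And _ p q => fun e => sat c p e /\ sat c q e
  | Or _ p q => fun e => sat c p e \/ sat c q e
  | All _ s p => fun e => forall x : dom F s, sat c p (x, e)
  | Ex _ s p => fun e => exists x : dom F s, sat c p (x, e)
  end.

Definition std_frame (R : realType) : frame :=
  @Frame (std R) (fun s t f => f) (fun P => P).

Record nonstandard_extension (R : realType) : Type := NonstandardExtension {
  nsframe :> frame;
  star : forall s, std R s -> dom nsframe s;
  transfer : forall p : formula R [::],
    @sat R (std_frame R) (fun s a => a) [::] p tt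
    <-> @sat R nsframe star [::] p tt;
  proper : exists x : dom nsframe tReal, forall r : R, x <> star (s := tReal) r
}.

Section Nonstandard.
Context (R : realType) (E : nonstandard_extension R).

Definition hreal : Type := dom E tReal.
Definition hvec (n : nat) : Type := dom E (tVec n).

(* internal functions from hvec n to hreal, as objects *)
Definition hfun (n : nat) : Type := dom E (tFun (tVec n) tReal).

Definition sreal (r : R) : hreal := star E (s := tReal) r.
Definition svec n (v : 'rV[R]_n) : hvec n := star E (s := tVec n) v.

Definition star1 s t (f : std R s -> std R t) (x : dom E s) : dom E t :=
  app (star E (s := tFun s t) f) x.
Definition star2 s t u (f : std R s -> std R t -> std R u)
    (x : dom E s) (y : dom E t) : dom E u :=
  app (app (star E (s := tFun s (tFun t u)) f) x) y.

Definition hadd : hreal -> hreal -> hreal :=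
  star2 (s := tReal) (t := tReal) (u := tReal) (fun x y => x + y).
Definition hsub : hreal -> hreal -> hreal :=
  star2 (s := tReal) (t := tReal) (u := tReal) (fun x y => x - y).
Definition hmul : hreal -> hreal -> hreal :=
  star2 (s := tReal) (t := tReal) (u := tReal) (fun x y => x * y).
Definition habs : hreal -> hreal :=
  star1 (s := tReal) (t := tReal) (fun x => `|x|).
Definition hle (x y : hreal) : Prop :=
  holds (star2 (s := tReal) (t := tReal) (u := tProp)
    (fun x y => is_true (x <= y)) x y).
Definition hlt (x y : hreal) : Prop :=
  holds (star2 (s := tReal) (t := tReal) (u := tProp)
    (fun x y => is_true (x < y)) x y).

(* MathComp's norm on row vectors is the sup norm. *)
Definition enorm n (v : 'rV[R]_n) : R := Num.sqrt (\sum_(i < n) v ord0 i ^+ 2).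

Definition hvsub n : hvec n -> hvec n -> hvec n :=
  star2 (s := tVec n) (t := tVec n) (u := tVec n) (fun v w => v - w).
Definition hnorm n : hvec n -> hreal :=
  star1 (s := tVec n) (t := tReal) (@enorm n).
Definition hcoord n (v : hvec n) (i : 'I_n) : hreal :=
  star1 (s := tVec n) (t := tReal) (fun v => v ord0 i) v.

Definition infinitesimal (x : hreal) : Prop :=
  forall r : R, 0 < r -> hlt (habs x) (sreal r).
Definition approx (x y : hreal) : Prop := infinitesimal (hsub x y).
Definition finite (x : hreal) : Prop :=
  exists2 r : R, 0 < r & hlt (habs x) (sreal r).
Definition nearstd (x : hreal) : Prop := exists b : R, approx x (sreal b).
Definition gtrsim (x y : hreal) : Prop := hle y x \/ approx x y.

Definition vinfinitesimal n (v : hvec n) : Prop :=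
  forall r : R, 0 < r -> hlt (hnorm v) (sreal r).
Definition vapprox n (v w : hvec n) : Prop := vinfinitesimal (hvsub v w).
Definition vfinite n (v : hvec n) : Prop :=
  exists2 r : R, 0 < r & hlt (hnorm v) (sreal r).
Definition vnearstd n (v : hvec n) : Prop :=
  exists b : 'rV[R]_n, vapprox v (svec b).

Definition internal s t (f : dom E s -> dom E t) : Prop :=
  exists F : dom E (tFun s t), forall x, f x = app F x.

(* L \in *L(R^n, R) *)
Definition hlinear n (L : hfun n) : Prop :=
  holds (star1 (s := tFun (tVec n) tReal) (t := tProp)
    (fun l : 'rV[R]_n -> R => scalar l) L).

Definition mu_derivative n (f : hvec n -> hreal) (Df : hvec n -> hfun n) :
    Prop :=
  [/\ internal (s := tVec n) (t := tFun (tVec n) tReal) Df,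
      forall x, hlinear (Df x),
      forall x, vnearstd x -> forall v, vfinite v -> finite (app (Df x) v)
    & forall b : 'rV[R]_n, exists d : hreal,
        [/\ hlt (sreal 0) d, infinitesimal d
          & forall x y, vapprox x (svec b) -> vapprox y (svec b) ->
              hlt d (hnorm (hvsub x y)) ->
              exists2 eta : hreal, infinitesimal eta &
                hsub (f x) (f y)
                = hadd (app (Df x) (hvsub x y)) (hmul (hnorm (hvsub x y)) eta)]].

Definition mu_differentiable n (f : hvec n -> hreal) : Prop :=
  [/\ internal (s := tVec n) (t := tReal) f,
      forall x, vnearstd x -> nearstd (f x)
    & exists Df, mu_derivative f Df].

Definition coordinates n (L : hfun n) (c : 'I_n -> hreal) : Prop :=
  forall v : hvec n,
    app L v = \big[hadd/sreal 0]_(i < n) hmul (c i) (hcoord v i).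

(* "the" coordinates of L; see coordsP and coordinates_inj below *)
Definition coords n (L : hfun n) : 'I_n -> hreal :=
  match pselect (exists c, coordinates L c) with
  | left h => sval (cid h)
  | right _ => fun=> sreal 0
  end.

Definition partial n (Df : hvec n -> hfun n) (i : 'I_n) (x : hvec n) : hreal :=
  coords (Df x) i.

Definition local_m_minimizer n (f : hvec n -> hreal) (a : 'rV[R]_n) : Prop :=
  exists2 r : R, 0 < r &
    forall x : hvec n, hlt (hnorm (hvsub x (svec a))) (sreal r) ->
      gtrsim (f x) (f (svec a)).

(* The coordinates of an internal linear map exist and are unique, so that
   coords and partial never take their default value on such maps. *)

Lemma hlinearE n (L : hfun n) (v : hvec n) (r : seq 'I_n) :
  star2 (s := tFun (tVec n) tReal) (t := tVec n) (u := tReal)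
    (fun l v => \sum_(i <- r) l (delta_mx ord0 i) * v ord0 i) L v
  = \big[hadd/sreal 0]_(i <- r)
      hmul (app L (svec (delta_mx ord0 i))) (hcoord v i).
Proof.
pose s := tFun (tVec n) tReal.
pose G := [:: tVec n; s].
pose l := Var R (VS _ (VZ _ _) : var G s).
pose w := Var R (VZ _ _ : var G (tVec n)).
pose K t (a : std R t) := Cst G a.
pose rrr := tFun tReal (tFun tReal tReal).
elim: r => [|i r IH].
  rewrite big_nil.
  have := (transfer E (@All R [::] s (@All R [:: s] (tVec n)
    (Eq (App (@App _ _ s s (@K (tFun s s) (fun l v =>
         \sum_(i <- [::]) l (delta_mx ord0 i) * v ord0 i)) l) w)
        (@K tReal 0))))).1.
  by apply=> /= *; rewrite big_nil.
rewrite big_cons -IH.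
have := (transfer E (@All R [::] s (@All R [:: s] (tVec n)
  (Eq (App (@App _ _ s s (@K (tFun s s) (fun l v =>
         \sum_(i <- i :: r) l (delta_mx ord0 i) * v ord0 i)) l) w)
      (App (App (@K rrr (fun x y => x + y))
         (App (App (@K rrr (fun x y => x * y))
            (App l (@K (tVec n) (delta_mx ord0 i))))
            (App (@K s (fun v => v ord0 i)) w)))
         (App (@App _ _ s s (@K (tFun s s) (fun l v =>
            \sum_(i <- r) l (delta_mx ord0 i) * v ord0 i)) l) w)))))).1.
by apply=> /= *; rewrite big_cons.
Qed.

Lemma coordinates_delta n (L : hfun n) : hlinear L ->
  coordinates L (fun i => app L (svec (delta_mx ord0 i))).
Proof.
move=> HL v; rewrite -hlinearE.
pose s := tFun (tVec n) tReal.
pose G := [:: tVec n; s].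
pose l := Var R (VS _ (VZ _ _) : var G s).
pose w := Var R (VZ _ _ : var G (tVec n)).
have := (transfer E (@All R [::] s (@All R [:: s] (tVec n)
  (Imp (Holds (@App R G s tProp (Cst _ (s := tFun s tProp)
            (fun l : 'rV[R]_n -> R => scalar l)) l))
       (Eq (App l w)
         (App (@App R G s s (Cst _ (s := tFun s s)
           (fun (l : 'rV[R]_n -> R) v =>
             \sum_(i < n) l (delta_mx ord0 i) * v ord0 i)) l) w)))))).1.
move=> H; apply: (H _ L v HL) => /= {H HL L v} f v lin.
have f0 : f 0 = 0 by have := lin (-1) 0 0; rewrite scaler0 addr0 mulN1r addNr.
have fD a b : f (a + b) = f a + f b by rewrite -[a]scale1r lin mul1r scale1r.
have fZ k a : f (k *: a) = k * f a by rewrite -[k *: a]addr0 lin f0 addr0.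
rewrite [in LHS](row_sum_delta v) (big_morph f fD f0).
by apply: eq_bigr => i _; rewrite fZ mulrC.
Qed.

Lemma coordinates_inj n (L : hfun n) (c c' : 'I_n -> hreal) :
  coordinates L c -> coordinates L c' -> c =1 c'.
Proof.
pose rrr := tFun tReal (tFun tReal tReal).
pose x := Var R (VZ [::] tReal).
pose K t (a : std R t) := Cst [:: tReal] a.
have a0 y : hadd y (sreal 0) = y.
  have := (transfer E (@All R [::] tReal
    (Eq (App (App (@K rrr (fun x y => x + y)) x) (@K tReal 0)) x))).1.
  by apply=> /= z; rewrite addr0.
have d0 y : hadd (sreal 0) y = y.
  have := (transfer E (@All R [::] tReal
    (Eq (App (App (@K rrr (fun x y => x + y)) (@K tReal 0)) x) x))).1.
  by apply=> /= z; rewrite add0r.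
have m0 y : hmul y (sreal 0) = sreal 0.
  have := (transfer E (@All R [::] tReal
    (Eq (App (App (@K rrr (fun x y => x * y)) x) (@K tReal 0)) (@K tReal 0)))).1.
  by apply=> /= z; rewrite mulr0.
have m1 y : hmul y (sreal 1) = y.
  have := (transfer E (@All R [::] tReal
    (Eq (App (App (@K rrr (fun x y => x * y)) x) (@K tReal 1)) x))).1.
  by apply=> /= z; rewrite mulr1.
have cE (i j : 'I_n) :
    hcoord (svec (delta_mx ord0 i)) j = sreal (j == i)%:R.
  have := (transfer E
    (Eq (App (Cst [::] (s := tFun (tVec n) tReal) (fun v => v ord0 j))
          (Cst [::] (s := tVec n) (delta_mx ord0 i)))
        (Cst [::] (s := tReal) (j == i)%:R))).1.
  by apply; rewrite /= mxE eqxx.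
suff ev d i : coordinates L d -> d i = app L (svec (delta_mx ord0 i)).
  by move=> Hc Hc' i; rewrite (ev c) // (ev c').
move=> ->.
suff sumE (r : seq 'I_n) : uniq r ->
    \big[hadd/sreal 0]_(j <- r) hmul (d j) (hcoord (svec (delta_mx ord0 i)) j)
    = if i \in r then d i else sreal 0.
  by rewrite sumE ?index_enum_uniq // mem_index_enum.
elim: r => [|j r IH]; first by rewrite big_nil.
rewrite /= => /andP[jr /IH {}IH]; rewrite big_cons IH cE inE eq_sym.
have [->|ij] := eqVneq i j; last by rewrite m0 d0.
by rewrite m1 (negPf jr) a0.
Qed.

Lemma coordsP n (L : hfun n) : hlinear L -> coordinates L (coords L).
Proof.
move=> /coordinates_delta HL; rewrite /coords.
by case: pselect => [h|[]]; [exact: svalP|exists (fun i =>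
  app L (svec (delta_mx ord0 i)))].
Qed.

End Nonstandard.

(* Main.v *)
Require Import Defs.
From mathcomp Require Import all_boot all_order all_algebra.
From mathcomp Require Import boolp reals.
From mathcomp Require Import classical_sets lra.

(** Condition (2) of mu-differentiability controls [f] near [a] only at
    infinitesimal scale, where the minimality condition [f x >~ f a] is void
    because [f x] and [f a] are infinitely close anyway. For a fixed real
    [e > 0] and a unit vector [v], however, the inequality
    [f a - f (a + t v) >= Df_a (- t v) - e t] defines an internal set of [t],
    so by overspill it persists up to some real [t > 0]. There minimality gives
    [f a - f (a + t v) <= e t], whence [Df_a v >= - 2 e]. Applying this to
    [v = e_i] and [v = - e_i] bounds the [i]-th partial derivative by [2 e]. *)

Set Implicit Arguments.
Unset Strict Implicit.
Unset Printing Implicit Defensive.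

Import Order.TTheory GRing.Theory Num.Theory.
Local Open Scope ring_scope.

(** * The Euclidean norm on standard row vectors *)

Section EuclideanNorm.
Context (R : realType) (n : nat).
Implicit Types v : 'rV[R]_n.

Lemma enormZ (t : R) v : enorm (t *: v) = `|t| * enorm v.
Proof.
rewrite /enorm -sqrtr_sqr -sqrtrM ?sqr_ge0// mulr_sumr.
by congr Num.sqrt; apply: eq_bigr => j _; rewrite mxE exprMn.
Qed.

Lemma enorm0 : enorm (0 : 'rV[R]_n) = 0.
Proof. by rewrite -(scale0r 0) enormZ normr0 mul0r. Qed.

Lemma enormN v : enorm (- v) = enorm v.
Proof. by rewrite -scaleN1r enormZ normrN1 mul1r. Qed.

Lemma enorm_delta (i : 'I_n) : enorm (delta_mx ord0 i : 'rV[R]_n) = 1.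
Proof.
rewrite /enorm (bigD1 i)//= mxE !eqxx expr1n big1 ?addr0 ?sqrtr1// => j ji.
by rewrite mxE (negPf ji) andbF expr0n.
Qed.

End EuclideanNorm.

(** * Notation for transferable sentences *)

Section FirstOrderSyntax.
Context (R : realType).

(** Applying the constant that names a standard function makes the interpretation in [E] convertible
    to [star1] or [star2]. A transferred sentence then matches a goal about [hadd], [hlt], etc. by
    conversion, and only its standard reading is left to prove. *)
Definition fn1 G s t (f : std R s -> std R t) (x : term R G s) : term R G t :=
  App (Cst G (s := tFun s t) f) x.

Definition fn2 G s t u (f : std R s -> std R t -> std R u)
    (x : term R G s) (y : term R G t) : term R G u :=
  App (fn1 (t := tFun t u) f x) y.

Definition tadd G := @fn2 G tReal tReal tReal (fun x y => x + y).
Definition tsub G := @fn2 G tReal tReal tReal (fun x y => x - y).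
Definition tmul G := @fn2 G tReal tReal tReal (fun x y => x * y).
Definition tabs G := @fn1 G tReal tReal (fun x => `|x|).
Definition tvsub G n := @fn2 G (tVec n) (tVec n) (tVec n) (fun v w => v - w).
Definition tnorm G n := @fn1 G (tVec n) tReal (@enorm R n).
Definition treal G (r : R) : term R G tReal := Cst G (s := tReal) r.
Definition tvec G n (v : 'rV[R]_n) : term R G (tVec n) := Cst G (s := tVec n) v.
Definition Le G (x y : term R G tReal) : formula R G :=
  Holds (fn2 (s := tReal) (t := tReal) (u := tProp) (fun x y : R => is_true (x <= y)) x y).
Definition Lt G (x y : term R G tReal) : formula R G :=
  Holds (fn2 (s := tReal) (t := tReal) (u := tProp) (fun x y : R => is_true (x < y)) x y).
Definition Linear G n (l : term R G (tFun (tVec n) tReal)) : formula R G :=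
  Holds (fn1 (s := tFun (tVec n) tReal) (t := tProp) (fun l : 'rV[R]_n -> R => scalar l) l).
Definition Neg G (p : formula R G) : formula R G := Imp p (Fal R G).

End FirstOrderSyntax.

Local Notation "#0" := (Var _ (VZ _ _)).
Local Notation "#1" := (Var _ (VS _ (VZ _ _))).
Local Notation "#2" := (Var _ (VS _ (VS _ (VZ _ _)))).
Local Notation "#3" := (Var _ (VS _ (VS _ (VS _ (VZ _ _))))).
Local Notation "p ==>> q" := (Imp p q) (at level 80, right associativity).
Local Notation "'ALL' s , p" := (@All _ _ s p) (at level 90, p at level 90).
Local Notation "'EX' s , p" := (@Ex _ _ s p) (at level 90, p at level 90).

(** * Overspill *)

(* [m] is the infimum of the failures of [P] beyond [d], if there are any. *)
Lemma first_failure (R : realType) (P : R -> Prop) (d : R) : 0 < d ->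
  exists m, (0 < m /\ forall t, d < t -> t < m -> P t) /\
    (1 <= m \/ exists t, (d < t /\ t < m + m) /\ (P t -> False)).
Proof.
move=> d0; pose B : set R := (fun t => d < t /\ ~ P t).
have lbB : lbound B d by move=> t [/ltW].
have [[t0 Bt0]|B0] := pselect (B !=set0)%classic; last first.
  (* Without failures, any [m] that is visibly not infinitesimal will do; this is what [1 <= m]
     records. *)
  exists (d + 1); split; [split; first lra|by left; lra].
  by move=> t dt _; apply: contrapT => Pt; apply: B0; exists t.
have infB : has_inf B by split; [exists t0|exists d].
have dm : d <= inf B by apply: lb_le_inf => //; exists t0.
have m0 : 0 < inf B by lra.
exists (inf B); split.
  split=> // t dt tm; apply: contrapT => Pt.
  by have := ge_inf infB.2 (conj dt Pt : B t); lra.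
(* The tolerance is [inf B] itself: a failure below [m + m] is infinitesimal as soon as [m] is. *)
right; have [t [dt Pt] tm] := inf_adherent m0 infB.
by exists t.
Qed.

Section Overspill.
Context (R : realType) (E : nonstandard_extension R).
Implicit Types d t m : hreal E.

Lemma hfirst_failure (P : dom E (tFun tReal tProp)) d : hlt (sreal E 0) d ->
  exists m, (hlt (sreal E 0) m /\
             forall t, hlt d t -> hlt t m -> holds (app P t)) /\
    (hle (sreal E 1) m \/
     exists t, (hlt d t /\ hlt t (hadd m m)) /\ (holds (app P t) -> False)).
Proof.
move: P d; refine ((transfer E
  (ALL tFun tReal tProp, ALL tReal, Lt (treal _ 0) #0 ==>>
    EX tReal, And
      (And (Lt (treal _ 0) #0)
        (ALL tReal, Lt #2 #0 ==>> Lt #0 #1 ==>> Holds (App #3 #0)))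
      (Or (Le (treal _ 1) #0)
        (EX tReal, And (And (Lt #2 #0) (Lt #0 (tadd #1 #1)))
          (Neg (Holds (App #3 #0))))))).1 _).
exact: first_failure.
Qed.

Lemma hlt_double_norm (r : R) d t m : hlt (sreal E 0) d -> hlt d t ->
  hlt t (hadd m m) -> hlt (habs m) (sreal E (r / 2)) -> hlt (habs t) (sreal E r).
Proof.
move: d t m; refine ((transfer E (ALL tReal, ALL tReal, ALL tReal,
  Lt (treal _ 0) #2 ==>> Lt #2 #1 ==>> Lt #1 (tadd #0 #0) ==>>
  Lt (tabs #0) (treal _ (r / 2)) ==>> Lt (tabs #1) (treal _ r))).1 _).
move=> /= d t m d0 dt tm; have t0 : 0 < t by lra.
by rewrite (gtr0_norm t0) ltr_norml => /andP[_]; lra.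
Qed.

Lemma hlt_le_norm (r : R) t m : hlt (sreal E 0) m ->
  ~ hlt (habs m) (sreal E r) -> hlt t (sreal E r) -> hlt t m.
Proof.
move: t m; refine ((transfer E (ALL tReal, ALL tReal, Lt (treal _ 0) #0 ==>>
  Neg (Lt (tabs #0) (treal _ r)) ==>> Lt #1 (treal _ r) ==>> Lt #1 #0)).1 _).
move=> /= t m m0 /negP; rewrite -leNgt gtr0_norm//; lra.
Qed.

Lemma hle_norm_lt1 m : hle (sreal E 1) m -> hlt (habs m) (sreal E 1) -> False.
Proof.
move: m; refine ((transfer E (ALL tReal, Le (treal _ 1) #0 ==>>
  Neg (Lt (tabs #0) (treal _ 1)))).1 _).
by move=> /= m m1; rewrite ltr_norml => /andP[_]; lra.
Qed.

(** If the [m] of [hfirst_failure] were infinitesimal, the failure below [m + m] would be too,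
    against the hypothesis. So [m] is not infinitesimal; a real [r] witnessing this satisfies
    [r <= m], and no failure lies between [d] and [r]. *)
Lemma overspill (P : dom E (tFun tReal tProp)) d : hlt (sreal E 0) d ->
  (forall t, hlt d t -> infinitesimal t -> holds (app P t)) ->
  exists2 r : R, 0 < r &
    forall t, hlt d t -> hlt t (sreal E r) -> holds (app P t).
Proof.
move=> d0 HP; have [m [[m0 Pm] far]] := hfirst_failure P d0.
have [im|] := pselect (infinitesimal m).
  case: far => [m1|[t [[dt tm] Pt]]].
    by case: (hle_norm_lt1 m1 (im _ ltr01)).
  case: Pt; apply: (HP _ dt) => r r0.
  by apply: (hlt_double_norm d0 dt tm); apply: im; lra.
move=> /existsNP[r /not_implyP[r0 rm]]; exists r => // t dt tr.
exact: Pm dt (hlt_le_norm m0 rm tr).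
Qed.

End Overspill.

(** * The descent inequality along a ray from [a] *)

Section Ray.
Context (R : realType) (E : nonstandard_extension R) (n : nat).
Context (a v : 'rV[R]_n).
Hypothesis v1 : enorm v = 1.
Implicit Types (d t eta : hreal E) (F L : hfun E n).

Let sray (t : R) : 'rV[R]_n := a + t *: v.

Definition hray (t : hreal E) : hvec E n :=
  star1 (s := tReal) (t := tVec n) sray t.

Local Notation tray := (fn1 (s := tReal) (t := tVec n) sray).

Let sray_sub (t : R) : enorm (sray t - a) = `|t|.
Proof. by rewrite /sray [a + _]addrC addrK enormZ v1 mulr1. Qed.

Let sub_sray (t : R) : enorm (a - sray t) = `|t|.
Proof. by rewrite -enormN opprB sray_sub. Qed.

Lemma vapprox_svec (w : 'rV[R]_n) : vapprox (svec E w) (svec E w).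
Proof.
move=> r r0; refine ((transfer E
  (Lt (tnorm (tvsub (tvec [::] w) (tvec _ w))) (treal _ r))).1 _).
by rewrite /= subrr enorm0.
Qed.

Lemma hnorm_hray t r : hlt (habs t) (sreal E r) ->
  hlt (hnorm (hvsub (hray t) (svec E a))) (sreal E r).
Proof.
move: t; refine ((transfer E (ALL tReal, Lt (tabs #0) (treal _ r) ==>>
  Lt (tnorm (tvsub (tray #0) (tvec _ a))) (treal _ r))).1 _).
by move=> /= t; rewrite sray_sub.
Qed.

Lemma lt_hnorm_hray d t : hlt (sreal E 0) d -> hlt d t ->
  hlt d (hnorm (hvsub (svec E a) (hray t))).
Proof.
move: d t; refine ((transfer E (ALL tReal, ALL tReal,
  Lt (treal _ 0) #1 ==>> Lt #1 #0 ==>>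
  Lt #1 (tnorm (tvsub (tvec _ a) (tray #0))))).1 _).
by move=> /= d t d0 dt; rewrite sub_sray gtr0_norm //; lra.
Qed.

Section Descent.
Context (e : R).

Let sdescent (F L : 'rV[R]_n -> R) (t : R) : Prop :=
  L (a - sray t) - e * t <= F a - F (sray t).

(** As the extension of a standard relation, this is an internal predicate of [t] even for
    nonstandard [F] and [L], as overspill demands. *)
Definition hdescent F L : dom E (tFun tReal tProp) :=
  star2 (s := tFun (tVec n) tReal) (t := tFun (tVec n) tReal)
    (u := tFun tReal tProp) sdescent F L.

Local Notation tdescent :=
  (fn2 (s := tFun (tVec n) tReal) (t := tFun (tVec n) tReal)
    (u := tFun tReal tProp) sdescent).

(** The increment has norm [t], so the error term is [t * eta], which exceeds [- e * t]. *)
Lemma hdescent_mu F L t eta :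
  hsub (app F (svec E a)) (app F (hray t))
  = hadd (app L (hvsub (svec E a) (hray t)))
         (hmul (hnorm (hvsub (svec E a) (hray t))) eta) ->
  hlt (sreal E 0) t -> hlt (habs eta) (sreal E e) ->
  holds (app (hdescent F L) t).
Proof.
move: F L t eta; refine ((transfer E
  (ALL tFun (tVec n) tReal, ALL tFun (tVec n) tReal, ALL tReal, ALL tReal,
    Eq (tsub (App #3 (tvec _ a)) (App #3 (tray #1)))
       (tadd (App #2 (tvsub (tvec _ a) (tray #1)))
             (tmul (tnorm (tvsub (tvec _ a) (tray #1))) #0)) ==>>
    Lt (treal _ 0) #1 ==>> Lt (tabs #0) (treal _ e) ==>>
    Holds (App (tdescent #3 #2) #1))).1 _).
move=> /= F L t eta + t0; rewrite /sdescent => ->.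
rewrite sub_sray (gtr0_norm t0) ltr_norml => /andP[eta_ge _]; nra.
Qed.

(** Descent reads [- s * L v - e * s <= F a - F (a + s v)], and the right side is below [e * s];
    dividing by [s] gives the bound. Infinite closeness is not expressible in a transferable
    sentence, so it enters through the real bound [e * s]. *)
Lemma hdescent_lower_bound F L (s : R) : 0 < s -> hlinear L ->
  (hle (app F (svec E a)) (app F (hray (sreal E s))) \/
   hlt (habs (hsub (app F (hray (sreal E s))) (app F (svec E a))))
     (sreal E (e * s))) ->
  holds (app (hdescent F L) (sreal E s)) -> 0 < e ->
  hle (sreal E (- (2 * e))) (app L (svec E v)).
Proof.
move=> s0 linL Fs Ps e0; move: F L linL Fs Ps; refine ((transfer E
  (ALL tFun (tVec n) tReal, ALL tFun (tVec n) tReal, Linear #0 ==>>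
    Or (Le (App #1 (tvec _ a)) (App #1 (tray (treal _ s))))
       (Lt (tabs (tsub (App #1 (tray (treal _ s))) (App #1 (tvec _ a))))
         (treal _ (e * s))) ==>>
    Holds (App (tdescent #1 #0) (treal _ s)) ==>>
    Le (treal _ (- (2 * e))) (App #0 (tvec _ v)))).1 _).
move=> /= F L linL Fs.
have L0 : L 0 = 0 by have := linL (-1) 0 0; rewrite scaler0 addr0 mulN1r addNr.
have -> : L v = - s^-1 * L (a - sray s).
  rewrite -[LHS]addr0 -[0]L0.
  have -> : a - sray s = - s *: v by rewrite /sray opprD addNKr scaleNr.
  rewrite -[- s *: v]addr0 linL L0 !addr0 mulrA mulNr mulrN opprK.
  by rewrite mulVf ?mul1r // gt_eqF.
rewrite /sdescent mulNr lerN2 ler_pdivrMl // => Ps.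
have es : 0 < e * s by rewrite mulr_gt0.
case: Fs => [Fs|]; first lra.
by rewrite ltr_norml => /andP[Fs _]; lra.
Qed.

End Descent.

End Ray.

(** * Bounds on the derivative at a minimizer *)

Lemma mu_derivative_minimizer_ge (R : realType) (E : nonstandard_extension R)
    (n : nat) (f : hvec E n -> hreal E) (Df : hvec E n -> hfun E n)
    (a v : 'rV[R]_n) (e : R) :
  internal (s := tVec n) (t := tReal) f -> mu_derivative f Df ->
  local_m_minimizer f a -> enorm v = 1 -> 0 < e ->
  hle (sreal E (- (2 * e))) (app (Df (svec E a)) (svec E v)).
Proof.
move=> [F fF] [_ linDf _ /(_ a)[d [d0 id muf]]] [rho rho0 min_a] v1 e0.
have lt0 t : hlt d t -> hlt (sreal E 0) t.
  move: d t d0 {id muf}; refine ((transfer E (ALL tReal, ALL tReal,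
    Lt (treal _ 0) #1 ==>> Lt #1 #0 ==>> Lt (treal _ 0) #0)).1 _).
  by move=> /= d t; exact: lt_trans.
have sreal_lt (x y : R) : x < y -> hlt (sreal E x) (sreal E y).
  by move=> xy; refine ((transfer E (Lt (treal [::] x) (treal _ y))).1 _).
have descends t : hlt d t -> infinitesimal t ->
    holds (app (hdescent a v e F (Df (svec E a))) t).
  move=> dt it.
  have rayt : vapprox (hray a v t) (svec E a).
    by move=> r r0; apply: hnorm_hray => //; exact: it.
  have [eta ieta feta] := muf _ _ (vapprox_svec E a) rayt
    (lt_hnorm_hray a v1 d0 dt).
  rewrite !fF in feta.
  by apply: (hdescent_mu v1 feta (lt0 _ dt)); apply: ieta.
have [r r0 Pr] := overspill d0 descends.
(* Descent holds at [s] because [s < r], and minimality because [s < rho]; [d < s] follows since [d]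
   is infinitesimal and [s] is a positive real. *)
have [s s0 [sr srho]] : exists2 s, 0 < s & s < r /\ s < rho.
  exists (Num.min r rho / 2); first by rewrite divr_gt0// lt_min r0.
  by have := ge_min r r rho; have := ge_min rho r rho;
     rewrite !lexx orbT /= => + +; lra.
have ds : hlt d (sreal E s).
  move: (id _ s0); move: d {d0 id muf lt0 descends Pr}.
  refine ((transfer E (ALL tReal,
    Lt (tabs #0) (treal _ s) ==>> Lt #0 (treal _ s))).1 _).
  by move=> /= d; exact/le_lt_trans/ler_norm.
apply: (hdescent_lower_bound s0 (linDf _) _ (Pr _ ds (sreal_lt _ _ sr)) e0).
rewrite -!fF.
have [|fs|fs] := min_a (hray a v (sreal E s)).
- apply: hnorm_hray => //.
  refine ((transfer E (Lt (tabs (treal [::] s)) (treal _ rho))).1 _).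
  by rewrite /= gtr0_norm.
- by left.
- by right; apply: fs; rewrite mulr_gt0.
Qed.

(** Linearity turns the lower bound at [- v] into an upper bound at [v]; the gap [e < r] makes both
    strict. *)
Lemma hlinear_norm_lt (R : realType) (E : nonstandard_extension R) (n : nat)
    (L : hfun E n) (v : 'rV[R]_n) (e r : R) : e < r -> hlinear L ->
  hle (sreal E (- e)) (app L (svec E v)) ->
  hle (sreal E (- e)) (app L (svec E (- v))) ->
  hlt (habs (app L (svec E v))) (sreal E r).
Proof.
move=> er; move: L; refine ((transfer E (ALL tFun (tVec n) tReal,
  Linear #0 ==>> Le (treal _ (- e)) (App #0 (tvec _ v)) ==>>
  Le (treal _ (- e)) (App #0 (tvec _ (- v))) ==>>
  Lt (tabs (App #0 (tvec _ v))) (treal _ r))).1 _).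
move=> /= L linL.
have L0 : L 0 = 0 by have := linL (-1) 0 0; rewrite scaler0 addr0 mulN1r addNr.
have -> : L (- v) = - L v.
  by rewrite -scaleN1r -[_ *: _]addr0 linL L0 addr0 mulN1r.
by move=> Lv LNv; rewrite ltr_norml; apply/andP; split; lra.
Qed.

Lemma coords_delta (R : realType) (E : nonstandard_extension R) (n : nat)
    (L : hfun E n) (i : 'I_n) :
  hlinear L -> coords L i = app L (svec E (delta_mx ord0 i)).
Proof.
move=> linL; exact: coordinates_inj (coordsP linL) (coordinates_delta linL) i.
Qed.

Theorem mainTheorem6 (R : realType) (E : nonstandard_extension R) (n : nat)
    (hn : (0 < n)%N) (f : hvec E n -> hreal E) (a : 'rV[R]_n)
    (f_internal : @internal R E (tVec n) tReal f)
    (f_mu : mu_differentiable f)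
    (a_min : local_m_minimizer f a)
    (Df : hvec E n -> hfun E n) (Df_der : mu_derivative f Df) :
  forall i : 'I_n, infinitesimal (partial Df i (svec E a)).
Proof.
move=> i r r0; have [_ linDf _ _] := Df_der.
rewrite /partial coords_delta //.
(* The directional bound loses a factor 2, so [r / 4] gives [r / 2], strictly below [r]. *)
have e0 : 0 < r / 4 by lra.
apply: (@hlinear_norm_lt _ _ _ _ _ (2 * (r / 4))) => //; first lra.
  exact: (mu_derivative_minimizer_ge f_internal Df_der a_min
    (enorm_delta R i) e0).
apply: (mu_derivative_minimizer_ge f_internal Df_der a_min _ e0).
by rewrite enormN enorm_delta.
Qed.
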